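(* Let $S$ be a numerical semigroup. Then $Q$ is an idempotent quark of $\mathcal{I}_0(S)$ if and only if $Q=\{0,f\}+S$ for some $f\in\mathrm{SG}(S)$.
   Context: $\mathbb{N}$ denotes the non-negative integers. A numerical semigroup $S$ is a submonoid of $(\mathbb{N},+)$ with finite complement in $\mathbb{N}$; the elements of $\mathbb{N}\setminus S$ are its gaps. A gap $f$ of $S$ is a special gap if $S\cup\{f\}$ is a numerical semigroup; $\mathrm{SG}(S)$ is the set of special gaps of $S$. For a set $X$ of integers, $X+S=\{x+s: x\in X, s\in S\}$. $\mathcal{I}_0(S)=\{E\subseteq\mathbb{N}: E+S\subseteq E,\ \min(E)=0\}$ is the set of ideals of $S$ with minimum $0$; it is a commutative monoid under $I+J=\{a+b: a\in I, b\in J\}$, with identity $S$, and $S$ is its only unit. $I$ is idempotent if $I+I=I$. For $I,J\in\mathcal{I}_0(S)$, $I\preceq J$ means $J=I+K$ for some $K\in\mathcal{I}_0(S)$, and $I\prec J$ means $I\preceq J$ and $J\not\preceq I$ (equivalently, $I\preceq J$ and $I\ne J$). A non-unit $Q$ (that is, $Q\neq S$) is a quark if there is no non-unit $J$ with $J\prec Q$. *)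

(* Defs.v *)
From mathcomp Require Import all_boot.
From mathcomp Require Import boolp classical_sets cardinality.

Set Implicit Arguments.
Unset Strict Implicit.
Unset Printing Implicit Defensive.

Local Open Scope classical_set_scope.

Definition sumset (X Y : set nat) : set nat := [set x + y | x in X & y in Y].

Definition numerical_semigroup (S : set nat) : Prop :=
  [/\ S 0, forall x y, S x -> S y -> S (x + y) & finite_set (~` S)].

Definition gap (S : set nat) (f : nat) : Prop := ~ S f.

Definition special_gap (S : set nat) : set nat :=
  [set f | gap S f /\ numerical_semigroup (S `|` [set f])].

Definition is_min (E : set nat) (m : nat) : Prop :=
  E m /\ forall x, E x -> m <= x.

(* The carrier of the monoid I_0(S); its operation is [sumset] and its
   identity is S. *)
Definition ideals0 (S : set nat) : set (set nat) :=
  [set E | sumset E S `<=` E /\ is_min E 0].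

(* Invertibility in I_0(S); for a numerical semigroup S it amounts to I = S. *)
Definition unit_ideal (S I : set nat) : Prop :=
  ideals0 S I /\ exists2 J, ideals0 S J & sumset I J = S.

Definition idempotent_ideal (I : set nat) : Prop := sumset I I = I.

Definition ideal_le (S I J : set nat) : Prop :=
  exists2 K, ideals0 S K & J = sumset I K.

Definition ideal_lt (S I J : set nat) : Prop :=
  ideal_le S I J /\ ~ ideal_le S J I.

Definition quark (S Q : set nat) : Prop :=
  [/\ ideals0 S Q, ~ unit_ideal S Q &
      ~ exists J, [/\ ideals0 S J, ~ unit_ideal S J & ideal_lt S J Q]].

(* Main.v *)
Require Import Defs.
From mathcomp Require Import all_boot.
From mathcomp Require Import boolp classical_sets cardinality.

Local Open Scope classical_set_scope.

(* The units of I_0(S) reduce to S, and every ideal contains S and lies below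
   its multiples for inclusion. An idempotent Q other than S is a semigroup
   containing S; by maximality, f = max (Q \ S) is a special gap, and {0, f} + S
   = S `|` {f} lies below Q since Q absorbs it, hence equals Q when Q is a quark. Conversely,
   nothing lies strictly between S and S `|` {f} for inclusion. *)

Lemma sumset_subl (I K : set nat) : K 0 -> I `<=` sumset I K.
Proof. by move=> K0 x Ix; exists x => //; exists 0; rewrite ?addn0. Qed.

Lemma sumset_idem (I : set nat) :
  I 0 -> (forall x y, I x -> I y -> I (x + y)) -> sumset I I = I.
Proof.
move=> I0 ID; apply/seteqP; split; last exact: sumset_subl.
by move=> _ [x Ix [y Iy <-]]; exact: ID.
Qed.

Lemma ideals0_sub (S I : set nat) : ideals0 S I -> S `<=` I.
Proof.
by move=> [IS [I0 _]] x Sx; apply: IS; exists 0 => //; exists x.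
Qed.

Lemma ideals0_sumsetr (S I : set nat) : S 0 -> ideals0 S I -> sumset I S = I.
Proof. by move=> S0 [IS _]; apply/seteqP; split=> //; exact: sumset_subl. Qed.

Lemma ideals0_refl (S : set nat) : numerical_semigroup S -> ideals0 S S.
Proof. by move=> [S0 SD _]; split; rewrite ?sumset_idem. Qed.

Lemma ideal_le_sub (S I J : set nat) : ideal_le S I J -> I `<=` J.
Proof. by move=> [K [_ [K0 _]] ->]; exact: sumset_subl. Qed.

Lemma ideal_le_refl (S I : set nat) :
  numerical_semigroup S -> ideals0 S I -> ideal_le S I I.
Proof.
move=> hS hI; exists S; first exact: ideals0_refl.
by case: hS => S0 _ _; rewrite ideals0_sumsetr.
Qed.

(** If [sumset I J = S] with [0] in [J], then [I] is contained in [S]; as an ideal with minimum [0]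
    it also contains [S]. *)
Lemma unit_idealP (S I : set nat) :
  numerical_semigroup S -> unit_ideal S I <-> I = S.
Proof.
move=> hS; split=> [[hI [J [_ [J0 _]] IJ]]|->].
  apply/seteqP; split; last exact: ideals0_sub.
  by rewrite -[X in _ `<=` X]IJ; exact: sumset_subl.
have hSS := ideals0_refl S hS; split=> //; exists S => //.
by case: hS => S0 _ _; exact: ideals0_sumsetr.
Qed.

(** The translate of [S] by [f] adds nothing beyond [f], because [S] with [f] adjoined is closed
    under addition. *)
Lemma special_gap_sumset (S : set nat) (f : nat) : S 0 -> special_gap S f ->
  sumset [set 0; f] S = S `|` [set f].
Proof.
move=> S0 [_ [_ SfD _]]; apply/seteqP; split=> [_ [a af [s Ss <-]]|x].
  by apply: SfD; [case: af => ->; [left|right]|left].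
case=> [Sx|->]; first by exists 0; [left|exists x].
by exists f; [right|exists 0; rewrite ?addn0].
Qed.

(** There are finitely many gaps, so the elements of [P] outside [S] are bounded by the maximum of a
    list of all gaps, and a largest one exists. *)
Lemma numerical_semigroup_gap_max (S : set nat) (P : set nat) :
  numerical_semigroup S -> P `\` S !=set0 ->
  exists2 f, (P `\` S) f & forall x, P x -> f < x -> S x.
Proof.
move=> [_ _ /finite_seqP[s sE]] [y0 Py0].
have exP : exists y, `[< (P `\` S) y >] by exists y0; apply/asboolP.
have ubP y : `[< (P `\` S) y >] -> y <= \max_(i <- s) i.
  move=> /asboolP[_ nSy]; apply: leq_bigmax_seq => //.
  by have : (~` S) y := nSy; rewrite sE.
case: (ex_maxnP exP ubP) => f /asboolP Pf fmax; exists f => // x Px fx.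
apply: contrapT => nSx.
have /fmax : `[< (P `\` S) x >] by apply/asboolP.
by rewrite leqNgt fx.
Qed.

(** Since [0] is in [S], [f] is positive. Hence [f + f], and [x + f] for positive [x] in [S], are
    elements of [Q] exceeding [f], so they fall in [S]. *)
Lemma special_gap_max (S Q : set nat) (f : nat) : numerical_semigroup S ->
  (forall x y, Q x -> Q y -> Q (x + y)) -> S `<=` Q -> (Q `\` S) f ->
  (forall x, Q x -> f < x -> S x) -> special_gap S f.
Proof.
move=> [S0 SD Sfin] QD SQ [Qf nSf] fmax; split=> //.
have f_gt0 : 0 < f by rewrite lt0n; apply/eqP => f0; apply: nSf; rewrite f0.
have SfD x : S x -> (S `|` [set f]) (x + f).
  move=> Sx; case: (posnP x) => [->|x_gt0]; first by right.
  by left; apply: fmax; [apply: QD => //; exact: SQ|rewrite -{1}[f]add0n ltn_add2r].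
split; first by left.
- move=> x y [Sx|->] [Sy|->]; [by left; exact: SD|exact: SfD| |].
    by rewrite addnC; exact: SfD.
  by left; apply: fmax; [exact: QD|rewrite -{1}[f]add0n ltn_add2r].
- by apply: sub_finite_set Sfin; apply: subsetC => x; left.
Qed.

Lemma special_gap_ideal (S : set nat) (f : nat) :
  special_gap S f -> ideals0 S (S `|` [set f]).
Proof.
move=> [_ [Sf0 SfD _]]; split=> // _ [x Sfx [s Ss <-]].
by apply: SfD => //; left.
Qed.

Lemma special_gap_not_unit (S : set nat) (f : nat) :
  numerical_semigroup S -> special_gap S f -> ~ unit_ideal S (S `|` [set f]).
Proof.
by move=> hS [nSf _] /(unit_idealP _ _ hS) SfS; apply: nSf; rewrite -SfS; right.
Qed.

Theorem proposition5p12 (S : set nat) (hS : numerical_semigroup S) (Q : set nat) :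
  (quark S Q /\ idempotent_ideal Q) <->
  (exists2 f : nat, special_gap S f & Q = sumset [set 0; f] S).
Proof.
have [S0 _ _] := hS; split=> [[[hQ nuQ Qmin] QQ]|[f hf ->]].
- have SQ := ideals0_sub _ _ hQ.
  have QD x y : Q x -> Q y -> Q (x + y).
    by move=> Qx Qy; rewrite -QQ; exists x => //; exists y.
  have QS0 : Q `\` S !=set0.
    apply/set0P/eqP => QS; apply: nuQ; apply/unit_idealP => //.
    by apply/seteqP; split=> //; rewrite -setD_eq0.
  have [f QSf fmax] := numerical_semigroup_gap_max _ _ hS QS0.
  have hf : special_gap S f by exact: special_gap_max QSf fmax.
  have SfQ : S `|` [set f] `<=` Q by move=> x [/SQ //|->]; case: QSf.
  exists f => //; rewrite special_gap_sumset //.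
  apply/seteqP; split=> //.
  (* If [Q] had an element outside [S] and different from [f], the ideal obtained by adjoining [f]
     to [S] would be a non-unit strictly below [Q]. *)
  apply: contrapT => nQSf; apply: Qmin; exists (S `|` [set f]).
  split; [exact: special_gap_ideal|exact: special_gap_not_unit|split].
    (* The cofactor is [Q] itself: adding to [Q] a subset of [Q] that contains [0] gives back
       [Q]. *)
    exists Q => //; apply/seteqP; split=> [x Qx|_ [x /SfQ Qx [y Qy <-]]].
      by exists 0; [left|exists x].
    exact: QD.
  by move=> /ideal_le_sub.
- have [_ [Sf0 SfD _]] := hf.
  rewrite special_gap_sumset //; split; last exact: sumset_idem.
  split; [exact: special_gap_ideal|exact: special_gap_not_unit|].
  move=> [J [hJ nuJ [/ideal_le_sub JSf nSfJ]]]; apply: nSfJ.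
  have SJ := ideals0_sub _ _ hJ.
  (* [J] lies between [S] and [S] with [f] adjoined; without [f] it would be [S], a unit. *)
  have Jf : J f.
    apply: contrapT => nJf; apply/nuJ/unit_idealP => //.
    apply/seteqP; split=> // x Jx.
    by case: (JSf _ Jx) => // xf; case: nJf; rewrite -xf.
  suff -> : S `|` [set f] = J by exact: ideal_le_refl.
  by apply/seteqP; split=> // x [/SJ //|->].
Qed.
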